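(* Let $\{X^u\}_{u\in\mathbb Z^n}$ be an $n$-parameter filtration of a cell complex $X$. For each grade $u\in\mathbb Z^n$ and each $q\ge0$, $$\mu_q(u)\ \le\ \sum_{i=0}^n\xi_i^{q-i}(u),$$ where $\mu_q(u)=\dim H_q(X^u,\bigcup_{j=1}^nX^{u-e_j})$ is the homological Morse number and $\xi^q_i(u)$ are the Betti tables of the persistence modules $V_q$ given by the $q$th homology of the filtration.
   Context: Fix a field $\mathbb F$; all homology is over $\mathbb F$ and $\dim$ of a vector space means $\dim_{\mathbb F}$. Cell complexes. A cell complex is a finite graded set $X=\bigsqcup_{q\ge 0}X_q$ (elements of $X_q$ are called $q$-cells) with an incidence function $\kappa:X\times X\to\mathbb F$ such that $\kappa(\tau,\sigma)\ne0$ implies $\dim\tau=\dim\sigma+1$, and $\sum_{\rho}\kappa(\tau,\rho)\kappa(\rho,\sigma)=0$ for all $\tau,\sigma$. Its chain complex $C_*(X)$ has $C_q(X)$ with basis $X_q$ and $\partial_q(\tau)=\sum_{\sigma\in X_{q-1}}\kappa(\tau,\sigma)\sigma$. The partial order $\le$ on $X$ is generated by $\sigma<\tau$ whenever $\kappa(\tau,\sigma)\neq0$. A subcomplex $A\subseteq X$ is a subset generating a chain subcomplex $C_*(A)\subseteq C_*(X)$. $H_q(X)$ is the homology of $C_*(X)$, and $H_q(X,A)$ that of $C_*(X)/C_*(A)$. Filtrations. For $n\ge1$, $[n]=\{1,\dots,n\}$, $e_1,\dots,e_n$ is the standard basis of $\mathbb Z^n$, $e_\sigma=\sum_{j\in\sigma}e_j$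 for $\sigma\subseteq[n]$, and $\preceq$ is the coordinatewise order on $\mathbb Z^n$. An $n$-parameter filtration of $X$ is a family $\{X^u\}_{u\in\mathbb Z^n}$ of subcomplexes with $X^u\subseteq X^v$ for $u\preceq v$. All filtrations are assumed one-critical, i.e. $X^u=\{\sigma\in X\mid f(\sigma)\preceq u\}$ for some order-preserving $f:(X,\le)\to(\mathbb Z^n,\preceq)$, and bounded, i.e. $X^u\neq\emptyset$ implies $0\preceq u$, and $X^u=X$ for $u$ sufficiently large. Homological Morse numbers: $\mu_q(u):=\dim H_q(X^u,\bigcup_{j=1}^nX^{u-e_j})$. Koszul complex and Betti tables. $V_q=H_q(\mathcal X)$ is the persistence module with $V_q^u=H_q(X^u)$ and maps $\iota_q^{u,v}:H_q(X^u)\to H_q(X^v)$ induced by inclusions. Its Koszul complex at grade $u$ has $\mathbb K_i(x_1,\dots,x_n;V_q)(u)=\bigoplus_{\sigma\subseteq[n],|\sigma|=i}H_q(X^{u-e_\sigma})$ for $0\le i\le n$ and $0$ otherwise; its differential $d_i$ restricted to the summand of $\sigma=\{j_1<\dots<j_i\}$ is $\sum_{r=0}^{i-1}(-1)^r\iota_q^{u-e_\sigma,\,u-e_{\sigma\setminus\{j_{i-r}\}}}$. The Betti table is $\xi_i^q(u):=\dim H_i(\mathbb K_*(x_1,\dots,x_n;V_q)(u))$ (so $\xi^q_i(u)=0$ unless $0\le i\le n$ and $q\ge0$). *)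

(* Defs.v *)
From HB Require Import structures.
From mathcomp Require Import all_boot all_order all_algebra.

Set Implicit Arguments.
Unset Strict Implicit.
Unset Printing Implicit Defensive.

Import Order.TTheory GRing.Theory Num.Theory.
Import Quotient.
Local Open Scope ring_scope.
Local Open Scope quotient_scope.

(* The quotient [V / U] : the library's quotient of additive groups, extended
   to a finite-dimensional vector space. *)
Section QuotientSpace.
Variables (K : fieldType) (V : vectType K) (U : {vspace V}).

Definition qspace : Type := {quot (pred_of_vspace U)}.
HB.instance Definition _ := GRing.Zmodule.on qspace.

Definition qpi (v : V) : qspace := \pi_({quot (pred_of_vspace U)}) v.
Definition qrepr (x : qspace) : V := repr (x : {quot (pred_of_vspace U)}).

Lemma qreprK : cancel qrepr qpi.
Proof. by move=> x; rewrite /qpi /qrepr reprK. Qed.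

Lemma qpi_eq v w : (qpi v == qpi w) = (v - w \in U).
Proof. by rewrite (idealrBE (pred_of_vspace U)). Qed.

Lemma qpi_add : {morph qpi : v w / v + w}.
Proof. by move=> v w; rewrite /qpi [LHS]pi_addr. Qed.

Lemma qreprB v : qrepr (qpi v) - v \in U.
Proof. by rewrite -qpi_eq qreprK. Qed.

Definition qscale (a : K) (x : qspace) : qspace := qpi (a *: qrepr x).

Lemma qpi_scale a v : qpi (a *: v) = qscale a (qpi v).
Proof.
apply/eqP; rewrite qpi_eq -scalerBr memvZ // -memvN opprB; exact: qreprB.
Qed.

Fact qscaleA a b x : qscale a (qscale b x) = qscale (a * b) x.
Proof. by rewrite -[x]qreprK -!qpi_scale scalerA. Qed.
Fact qscale1 : left_id 1 qscale.
Proof. by move=> x; rewrite -[x]qreprK -qpi_scale scale1r. Qed.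
Fact qscaleDr : right_distributive qscale +%R.
Proof.
by move=> a x y; rewrite -[x]qreprK -[y]qreprK -qpi_add -!qpi_scale -qpi_add
  scalerDr.
Qed.
Fact qscaleDl x : {morph qscale^~ x : a b / a + b}.
Proof.
by move=> a b /=; rewrite -[x]qreprK -!qpi_scale scalerDl qpi_add.
Qed.

HB.instance Definition _ := GRing.Zmodule_isLmodule.Build K qspace
  qscaleA qscale1 qscaleDr qscaleDl.

Lemma qpi_is_linear : linear qpi.
Proof. by move=> a v w; rewrite qpi_add qpi_scale. Qed.
HB.instance Definition _ := GRing.isSemilinear.Build K V qspace _ qpi
  (GRing.semilinear_linear qpi_is_linear).

Lemma qpi_eq0 v : (qpi v == 0) = (v \in U).
Proof. by rewrite -[0](linear0 qpi) qpi_eq subr0. Qed.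

Fact qspace_vect_iso : Vector.axiom (\dim U^C) qspace.
Proof.
pose p := daddv_pi (U^C)%VS U.
have pD v : p v + projv U v = v.
  by apply: daddv_pi_add; [rewrite capvC capv_compl|
    rewrite addvC addv_complf memvf].
have pU v : v \in U -> p v = 0.
  by move=> /projv_id Uv; apply: (addIr (projv U v)); rewrite pD add0r Uv.
have pC v : v \in (U^C)%VS -> p v = v.
  by move=> Cv; apply: daddv_pi_id => //; rewrite capvC capv_compl.
have p_qpi v : p (qrepr (qpi v)) = p v.
  by move: (pU _ (qreprB v)); rewrite linearB => /eqP; rewrite subr_eq0 => /eqP.
exists (fun x => \row_i coord (vbasis U^C) i (p (qrepr x))).
  move=> a x y; rewrite -[x]qreprK -[y]qreprK -linearP.
  by apply/rowP=> i; rewrite !mxE !p_qpi !linearP.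
exists (fun r : 'rV_(\dim U^C) => qpi (\sum_i r 0 i *: (vbasis U^C)`_i)).
  move=> x; rewrite -[RHS]qreprK; apply/eqP; rewrite qpi_eq.
  under eq_bigr do rewrite mxE.
  rewrite -coord_vbasis ?memv_pi // -{2}[qrepr x]pD opprD addNKr memvN.
  exact: memv_proj.
move=> r; apply/rowP=> i; rewrite mxE p_qpi pC.
  by rewrite coord_sum_free ?(basis_free (vbasisP _)).
by apply: rpred_sum => j _; rewrite rpredZ ?vbasis_mem ?memt_nth.
Qed.
HB.instance Definition _ := Lmodule_hasFinDim.Build K qspace qspace_vect_iso.
End QuotientSpace.

(* The map [V / U -> V' / U'] induced by [f : V -> V'] when [f] maps [U] into
   [U'] (see [qmapE]; no meaning otherwise). *)
Definition qmap (K : fieldType) (V V' : vectType K) (f : 'Hom(V, V'))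
    (U : {vspace V}) (U' : {vspace V'}) : 'Hom(qspace U, qspace U') :=
  linfun (fun x => qpi U' (f (qrepr x))).

Lemma qmapE (K : fieldType) (V V' : vectType K) (f : 'Hom(V, V'))
    (U : {vspace V}) (U' : {vspace V'}) v :
  (f @: U <= U')%VS -> qmap f U U' (qpi U v) = qpi U' (f v).
Proof.
move=> fU; pose g (x : qspace U) := qpi U' (f (qrepr x)).
have gE w : g (qpi U w) = qpi U' (f w).
  apply/eqP; rewrite qpi_eq -linearB (subvP fU) ?memv_img //; exact: qreprB.
have g_lin : linear g.
  move=> a x y; rewrite -[x]qreprK -[y]qreprK -linearP !gE.
  by rewrite linearP linearP.
pose gL := GRing.isSemilinear.Build K _ _ _ g (GRing.semilinear_linear g_lin).
pose h : {linear qspace U -> qspace U'} := HB.pack g gL.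
by rewrite /qmap (lfunE h) [LHS]gE.
Qed.

(* Dependent variant of the library's vector space {ffun I -> V}. *)
Section DirectSum.
Variables (K : fieldType) (I : finType) (T : I -> vectType K).

Definition dsum : Type := {dffun forall i : I, T i}.
HB.instance Definition _ := Choice.on dsum.

Implicit Types x y : dsum.
Definition dsum_of (g : forall i, T i) : dsum := [ffun i => g i].
Definition dsum_zero := dsum_of (fun=> 0).
Definition dsum_opp x := dsum_of (fun i => - x i).
Definition dsum_add x y := dsum_of (fun i => x i + y i).
Definition dsum_scale a x := dsum_of (fun i => a *: x i).

Fact dsum_addA : associative dsum_add.
Proof. by move=> x y z; apply/ffunP=> i; rewrite !ffunE addrA. Qed.
Fact dsum_addC : commutative dsum_add.
Proof. by move=> x y; apply/ffunP=> i; rewrite !ffunE addrC. Qed.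
Fact dsum_add0 : left_id dsum_zero dsum_add.
Proof. by move=> x; apply/ffunP=> i; rewrite !ffunE add0r. Qed.
Fact dsum_addN : left_inverse dsum_zero dsum_opp dsum_add.
Proof. by move=> x; apply/ffunP=> i; rewrite !ffunE addNr. Qed.
HB.instance Definition _ := GRing.isZmodule.Build dsum
  dsum_addA dsum_addC dsum_add0 dsum_addN.

Fact dsum_scaleA a b x : dsum_scale a (dsum_scale b x) = dsum_scale (a * b) x.
Proof. by apply/ffunP=> i; rewrite !ffunE scalerA. Qed.
Fact dsum_scale1 : left_id 1 dsum_scale.
Proof. by move=> x; apply/ffunP=> i; rewrite !ffunE scale1r. Qed.
Fact dsum_scaleDr : right_distributive dsum_scale +%R.
Proof. by move=> a x y; apply/ffunP=> i; rewrite !ffunE scalerDr. Qed.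
Fact dsum_scaleDl x : {morph dsum_scale^~ x : a b / a + b}.
Proof. by move=> a b; apply/ffunP=> i; rewrite !ffunE scalerDl. Qed.
HB.instance Definition _ := GRing.Zmodule_isLmodule.Build K dsum
  dsum_scaleA dsum_scale1 dsum_scaleDr dsum_scaleDl.

Lemma dsumD x y i : (x + y) i = x i + y i. Proof. exact: ffunE. Qed.
Lemma dsumZ a x i : (a *: x) i = a *: x i. Proof. exact: ffunE. Qed.
Lemma dsum0 i : (0 : dsum) i = 0. Proof. exact: ffunE. Qed.

Let J : finType := {i : I & 'I_(\dim {: T i})}.
Fact dsum_vect_iso : Vector.axiom #|J| dsum.
Proof.
pose c i (j : 'I_(\dim {: T i})) := coord (vbasis {: T i}) j.
exists (fun x => \row_(k < #|J|)
  c (tag (enum_val k)) (tagged (enum_val k)) (x (tag (enum_val k)))).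
  by move=> a x y; apply/rowP=> k; rewrite !mxE dsumD dsumZ /c linearP.
exists (fun r : 'rV_#|J| => dsum_of (fun i =>
  \sum_(j < \dim {: T i}) r 0 (enum_rank (Tagged _ j : J))
    *: (vbasis {: T i})`_j)).
  move=> x; apply/ffunP=> i; rewrite ffunE [RHS](coord_vbasis (memvf _)).
  by apply: eq_bigr => j _; rewrite mxE enum_rankK.
move=> r; apply/rowP=> k; rewrite mxE ffunE /c coord_sum_free; last first.
  exact: basis_free (vbasisP _).
by congr (r 0 _); case: (enum_val k) (enum_valK k).
Qed.
HB.instance Definition _ := Lmodule_hasFinDim.Build K dsum dsum_vect_iso.

Definition dsum_in (i : I) (y : T i) : dsum := dsum_of (@dfwith I T (fun=> 0) i y).

Lemma dsum_in_is_linear i : linear (@dsum_in i).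
Proof.
move=> a y z; apply/ffunP=> j; rewrite dsumD dsumZ !ffunE.
case: (eqVneq i j) => [ij|ij]; last by rewrite !dfwith_out // scaler0 addr0.
by case: _ / ij; rewrite !dfwith_in.
Qed.
HB.instance Definition _ i := GRing.isSemilinear.Build K (T i) dsum _
  (@dsum_in i) (GRing.semilinear_linear (@dsum_in_is_linear i)).
End DirectSum.

(* Homology of a chain complex, given as a space [V] with an endomorphism [d]
   and subspaces [G 0, G 1, ...] (the homogeneous pieces) such that [d] maps
   [G q.+1] into [G q] and [G 0] to [0]. *)
Section Homology.
Variables (K : fieldType) (V : vectType K) (d : 'End(V)).
Variables (G : nat -> {vspace V}) (q : nat).

Definition cycles : {vspace V} := (G q :&: lker d)%VS.
Definition boundaries : {vspace V} := (d @: G q.+1)%VS.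

Definition boundaries_in_cycles : {vspace subvs_of cycles} :=
  (linfun (vsval : subvs_of cycles -> V) @^-1: boundaries)%VS.

Definition homology : vectType K := qspace boundaries_in_cycles.

(* The class of [z]; meaningful for [z \in cycles]. *)
Definition hclass (z : V) : homology :=
  qpi boundaries_in_cycles (vsproj cycles z).

Lemma hclass_eq0 z : z \in cycles -> (hclass z == 0) = (z \in boundaries).
Proof.
by move=> Zz; rewrite qpi_eq0 -memv_preim lfunE /= vsprojK.
Qed.

Lemma hclass_surj (h : homology) : exists2 z, z \in cycles & h = hclass z.
Proof.
by exists (vsval (qrepr h)); rewrite ?subvsP // /hclass vsvalK qreprK.
Qed.

Lemma hclass_is_linear : linear hclass.
Proof. by move=> a x y; rewrite /hclass !linearP. Qed.
HB.instance Definition _ := GRing.isSemilinear.Build K V homology _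
  hclass (GRing.semilinear_linear hclass_is_linear).
End Homology.

(* The map induced in homology by a map [f] preserving cycles and
   boundaries (see [hmapE]). *)
Definition hmap (K : fieldType) (V V' : vectType K) (d : 'End(V))
    (d' : 'End(V')) (G : nat -> {vspace V}) (G' : nat -> {vspace V'}) (q : nat)
    (f : 'Hom(V, V')) : 'Hom(homology d G q, homology d' G' q) :=
  qmap (linfun (vsproj (cycles d' G' q) \o f \o
                (vsval : subvs_of (cycles d G q) -> V))) _ _.

Lemma hmapE (K : fieldType) (V V' : vectType K) (d : 'End(V))
    (d' : 'End(V')) (G : nat -> {vspace V}) (G' : nat -> {vspace V'}) (q : nat)
    (f : 'Hom(V, V')) z :
  (f @: cycles d G q <= cycles d' G' q)%VS ->
  (f @: boundaries d G q <= boundaries d' G' q)%VS ->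
  z \in cycles d G q -> hmap d d' G G' q f (hclass d G q z) =
    hclass d' G' q (f z).
Proof.
move=> fZ fB Zz; rewrite /hmap qmapE.
  by rewrite lfunE /= vsprojK.
apply/subvP=> _ /memv_imgP[w Bw ->]; rewrite -memv_preim !lfunE /=.
rewrite vsprojK ?(subvP fZ) ?memv_img ?subvsP //.
by apply: (subvP fB); rewrite memv_img //; move: Bw; rewrite -memv_preim lfunE.
Qed.

Record cellComplex (F : fieldType) := CellComplex {
  cell :> finType;
  cdim : cell -> nat;
  incid : cell -> cell -> F;
  incid_dim : forall t s, incid t s != 0 -> cdim t = (cdim s).+1;
  incid_sq : forall t s, \sum_r incid t r * incid r s = 0
}.

Section CellChains.
Variables (F : fieldType) (X : cellComplex F).

Definition face_le : rel X := connect (fun s t : X => incid t s != 0).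

(* All dimensions at once; the graded pieces are the [qchains] below. *)
Definition chain : vectType F := {ffun X -> F^o}.
Definition cellv (t : X) : chain := [ffun s => (s == t)%:R].

Definition bd_fun (c : chain) : chain :=
  \sum_(t : X) c t *: \sum_(s : X) incid t s *: cellv s.

Lemma bd_fun_is_linear : linear bd_fun.
Proof.
move=> a c c'; rewrite /bd_fun scaler_sumr -big_split /=.
by apply: eq_bigr => t _; rewrite !ffunE scalerDl scalerA.
Qed.
HB.instance Definition _ := GRing.isSemilinear.Build F chain chain _
  bd_fun (GRing.semilinear_linear bd_fun_is_linear).

Definition bd : 'End(chain) := linfun bd_fun.

Lemma bd_cell t : bd (cellv t) = \sum_s incid t s *: cellv s.
Proof.
rewrite lfunE /= /bd_fun (bigD1 t) //= ffunE eqxx scale1r.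
rewrite [X in _ + X]big1 ?addr0 // => s /negPf st.
by rewrite ffunE st scale0r.
Qed.

Definition chains (A : {set X}) : {vspace chain} :=
  <<[seq cellv t | t in A]>>%VS.
Definition qchains (A : {set X}) (q : nat) : {vspace chain} :=
  <<[seq cellv t | t in [set t in A | cdim t == q]]>>%VS.

Definition subcomplex (A : {set X}) : bool := (bd @: chains A <= chains A)%VS.

Definition Hq (A : {set X}) (q : nat) : vectType F := homology bd (qchains A) q.

Definition Hincl (A B : {set X}) (q : nat) : 'Hom(Hq A q, Hq B q) :=
  hmap bd bd (qchains A) (qchains B) q \1%VF.

(* [C_q(A) / C_q(B)], for [B] a subset of [A], is the image of [C_q(A)] in
   [C(X) / C(B)]. *)
Definition rel_qchains (A B : {set X}) (q : nat) : {vspace qspace (chains B)} :=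
  (linfun (qpi (chains B)) @: qchains A q)%VS.

Definition Hq_rel (A B : {set X}) (q : nat) : vectType F :=
  homology (qmap bd (chains B) (chains B)) (rel_qchains A B) q.
End CellChains.

Section Grades.
Variable n : nat.

Definition grade := 'rV[int]_n.
Definition grade_le (u v : grade) : bool := [forall j, u 0 j <= v 0 j].
Definition e_set (S : {set 'I_n}) : grade := \sum_(j in S) delta_mx 0 j.
End Grades.

(* One-criticality and boundedness are part of the notion of filtration. *)
Record filtration (F : fieldType) (X : cellComplex F) (n : nat) := Filtration {
  level :> grade n -> {set X};
  level_subcomplex : forall u, subcomplex (level u);
  level_mono : forall u v, grade_le u v -> level u \subset level v;
  level_one_critical : exists f : X -> grade n,
    (forall s t, face_le s t -> grade_le (f s) (f t)) /\
    (forall u, level u = [set s | grade_le (f s) u]);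
  level_bounded_below : forall u, level u != set0 -> grade_le 0 u;
  level_exhaustive : exists u0, forall u, grade_le u0 u -> level u = [set: X]
}.

Section Invariants.
Variables (F : fieldType) (X : cellComplex F) (n : nat) (Xf : filtration X n).

Definition morse (q : nat) (u : grade n) : nat :=
  \dim {: Hq_rel (Xf u) (\bigcup_(j < n) Xf (u - delta_mx 0 j)) q}.

Section Koszul.
Variables (q : nat) (u : grade n).

Definition koszul : vectType F :=
  dsum (fun S : {set 'I_n} => Hq (Xf (u - e_set S)) q).

Definition koszul_gr (i : nat) : {vspace koszul} :=
  (\sum_(S : {set 'I_n} | #|S| == i) limg (linfun (@dsum_in _ _ _ S)))%VS.

(* For S = {j_1 < ... < j_i}, the sign (-1)^r is attached to j = j_(i-r), that
   is, r is the number of elements of S greater than j. *)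
Definition koszul_fun (x : koszul) : koszul :=
  \sum_(S : {set 'I_n}) \sum_(j in S)
    (-1) ^+ #|[set k in S | (j < k)%N]| *:
      dsum_in (Hincl (Xf (u - e_set S)) (Xf (u - e_set (S :\ j))) q (x S)).

Lemma koszul_fun_is_linear : linear koszul_fun.
Proof.
move=> a x y; rewrite /koszul_fun scaler_sumr -big_split /=.
apply: eq_bigr => S _; rewrite scaler_sumr -big_split /=.
apply: eq_bigr => j _; by rewrite dsumD dsumZ !linearP.
Qed.
HB.instance Definition _ := GRing.isSemilinear.Build F koszul koszul _
  koszul_fun (GRing.semilinear_linear koszul_fun_is_linear).

Definition koszul_diff : 'End(koszul) := linfun koszul_fun.
End Koszul.

(* [betti i q u] is the Betti table entry xi_i^q(u), with V_q = 0 for q < 0. *)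
Definition betti (i : nat) (q : int) (u : grade n) : nat :=
  match q with
  | Posz p => \dim {: homology (koszul_diff p u) (koszul_gr p u) i}
  | Negz _ => 0
  end.
End Invariants.

(* Main.v *)
(* The chain groups of the levels [X^(u - e_S)], [S] a set of parameters, form a
   double complex, with total complex [T]. For a fixed cell of X^u the [S] with
   the cell in [X^(u - e_S)] form a full simplex, by one-criticality; the Koszul
   direction is therefore acyclic on the cells of the union of the X^(u - e_j),
   and every relative cycle lifts, by a zig-zag, to a cycle of [T]. So
   [H_q(T)] surjects onto the relative homology. Filter the cycles of [T] by
   [#|S|]: the leading term of a cycle of filtration degree [i] is a Koszul cycle
   of homology classes, and when that is a Koszul boundary the cycle is
   homologous to one of lower degree. Hence the image of the [i]th graded piece
   has dimension at most [xi_i^(q-i)(u)]; this is the bound of the abutment of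
   the spectral sequence by its second page, without the spectral sequence. *)

Require Import Defs.
From HB Require Import structures.
From mathcomp Require Import all_boot all_order all_algebra.
Import Order.TTheory GRing.Theory Num.Theory.
Set Implicit Arguments.
Unset Strict Implicit.
Unset Printing Implicit Defensive.
Local Open Scope ring_scope.

(** On the complement [U :\: lker g] of [U :&: lker g] in [U], [g] is injective, so that part
    contributes at most [\dim {: P}]; the kernel part lands in [f @: U']. *)
Lemma dim_limg_step (K : fieldType) (V R P : vectType K) (f : 'Hom(V, R))
    (g : 'Hom(V, P)) (U U' : {vspace V}) :
  (forall z, z \in U -> g z = 0 -> f z \in (f @: U')%VS) ->
  (\dim (f @: U) <= \dim (f @: U') + \dim {: P})%N.
Proof.
move=> fU'; rewrite -{1}(addv_diff_cap U (lker g)) limgD addvC.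
apply: leq_trans (dimv_add_leqif _ _) (leq_add _ _).
  apply: dimvS; apply/subvP=> _ /memv_imgP[z + ->].
  by rewrite memv_cap memv_ker => /andP[Uz /eqP]; exact: fU'.
apply: (@leq_trans (\dim (U :\: lker g))).
  by rewrite -(limg_ker_dim f (U :\: lker g)) leq_addl.
by rewrite -(@limg_dim_eq _ _ _ g) ?capv_diff // dimvS ?subvf.
Qed.

(** * Cellular chains as coefficient functions *)

Section Chains.
Variables (F : fieldType) (X : cellComplex F).
Implicit Types (c : chain X) (A B : {set X}).

Lemma bdE c s : bd X c s = \sum_t (c t : F) * incid t s :> F.
Proof.
rewrite lfunE /= /bd_fun sum_ffunE; apply: eq_bigr => t _.
rewrite !ffunE sum_ffunE (bigD1 s) //= !ffunE eqxx big1 ?addr0.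
  by rewrite /GRing.scale /= mulr1.
by move=> r rs; rewrite !ffunE eq_sym (negPf rs) scaler0.
Qed.

Lemma bd_bd c : bd X (bd X c) = 0.
Proof.
apply/ffunP=> s; rewrite bdE ffunE.
under eq_bigr do rewrite bdE mulr_suml.
rewrite exchange_big /= big1 // => t _.
under eq_bigr do rewrite -mulrA.
by rewrite -mulr_sumr incid_sq mulr0.
Qed.

Lemma bd_neq0 c s : bd X c s != 0 -> exists2 t, c t != 0 & incid t s != 0.
Proof.
rewrite bdE => /eqP nz; apply/exists_inP; apply: contra_notT nz => /exists_inPn H.
apply: big1 => t _; have [->|ct] := eqVneq (c t) 0; first by rewrite mul0r.
by have /negPn/eqP -> := H t ct; rewrite mulr0.
Qed.

Lemma mem_chains A c :
  reflect (forall s, c s != 0 -> s \in A) (c \in chains A).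
Proof.
apply: (iffP idP) => [Ac s|H].
  apply: contraNT => sA; rewrite (coord_span Ac) sum_ffunE big1 // => i _.
  rewrite [X in X = _]ffunE; have /imageP[t At ->] : (in_tuple [seq cellv t | t in A])`_i
      \in [seq cellv t | t in A] by rewrite mem_nth ?size_image.
  rewrite ffunE; case: eqP => [st|]; last by rewrite scaler0.
  by rewrite st At in sA.
have -> : c = \sum_t c t *: cellv t.
  apply/ffunP=> s; rewrite sum_ffunE (bigD1 s) //= !ffunE eqxx big1 ?addr0.
    by rewrite /GRing.scale /= mulr1.
  by move=> r rs; rewrite !ffunE eq_sym (negPf rs) scaler0.
apply: rpred_sum => t _; have [->|ct] := eqVneq (c t) 0.
  by rewrite scale0r mem0v.
by rewrite memvZ // memv_span // image_f ?H.
Qed.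

Lemma mem_qchains A q c :
  reflect (forall s, c s != 0 -> s \in A /\ cdim s = q) (c \in qchains A q).
Proof.
apply: (iffP (mem_chains [set t in A | cdim t == q] c)) => H s /H.
  by rewrite inE => /andP[-> /eqP].
by rewrite inE => -[-> ->] /=.
Qed.

Lemma subcomplexP A :
  reflect (forall t s, t \in A -> incid t s != 0 -> s \in A) (subcomplex A).
Proof.
apply: (iffP subvP) => [cA t s At ts|cA _ /memv_imgP[c /mem_chains Ac ->]].
  have /mem_chains : bd X (cellv t) \in chains A.
    by apply: cA; rewrite memv_img // memv_span // image_f.
  apply; rewrite bdE (bigD1 t) //= ffunE eqxx mul1r big1 ?addr0 // => r rt.
  by rewrite ffunE (negPf rt) mul0r.
by apply/mem_chains => s /bd_neq0[t /Ac At]; exact: cA.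
Qed.

Lemma bd_qchains A q c : subcomplex A -> c \in qchains A q.+1 ->
  bd X c \in qchains A q.
Proof.
move=> /subcomplexP cA /mem_qchains Ac; apply/mem_qchains => s /bd_neq0[t].
move=> /Ac[At dt] ts; split; first exact: cA ts.
by apply/eqP; rewrite -eqSS -dt (incid_dim ts).
Qed.

Lemma qchainsS A B q : A \subset B -> (qchains A q <= qchains B q)%VS.
Proof.
move=> /subsetP AB; apply/subvP => c /mem_qchains Ac.
by apply/mem_qchains => s /Ac[/AB].
Qed.

Lemma Hincl_hclass A B q z : A \subset B -> z \in cycles (bd X) (qchains A) q ->
  Hincl A B q (hclass (bd X) (qchains A) q z) = hclass (bd X) (qchains B) q z.
Proof.
move=> AB Zz; rewrite hmapE ?id_lfunE ?lim1g //.
  exact: capvS (qchainsS _ AB) (subvv _).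
by apply/limgS/qchainsS.
Qed.
End Chains.

(** * Koszul signs *)

Section KoszulSigns.
Variables (K : comPzRingType) (n : nat).
Implicit Types (S : {set 'I_n}) (j k : 'I_n).

Definition ksign S j : K := (-1) ^+ #|[set k in S | (j < k)%N]|.

Lemma ksignU1 S j k : k \notin S ->
  ksign (k |: S) j = (-1) ^+ (j < k)%N * ksign S j.
Proof.
move=> kS; rewrite /ksign -exprD; congr (_ ^+ _).
rewrite (cardsD1 k) !inE eqxx /=; congr (_ + _)%N; apply: eq_card => i.
by rewrite !inE; case: eqVneq => // ->; rewrite (negPf kS).
Qed.

(** Reconciles the signs of [koszul_fun], read at the source, with those of [kdiff], read at the
    target. *)
Lemma ksignU1id S j : ksign (j |: S) j = ksign S j.
Proof.
have [jS|jS] := boolP (j \in S); first by rewrite (setUidPr _) ?sub1set.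
by rewrite ksignU1 // ltnn mul1r.
Qed.

Lemma ksign_sq S j : ksign S j * ksign S j = 1.
Proof. by rewrite -expr2 sqrr_sign. Qed.

Lemma ksign_max S j : (forall k, k \in S -> (k <= j)%N) -> ksign S j = 1.
Proof.
move=> H; rewrite /ksign (_ : [set _ in _ | _] = set0) ?cards0 //.
by apply/setP=> k; rewrite !inE; apply/andP=> -[/H]; rewrite leqNgt => /negPf ->.
Qed.
End KoszulSigns.

(** * The Koszul differential and its contraction *)

Section KoszulDifferential.
Variables (K : comPzRingType) (V : lmodType K) (n : nat).
Implicit Types (S : {set 'I_n}) (j m : 'I_n) (a : {set 'I_n} -> V).

Definition kdiff a S : V := \sum_(j | j \notin S) ksign K S j *: a (j |: S).

(** The sign of the smaller of two indices depends on whether the larger is still present, so the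
    two orders of removing a pair cancel. *)
Lemma kdiff_kdiff a S : kdiff (kdiff a) S = 0.
Proof.
pose b j k := ksign K S j *: (ksign K (j |: S) k *: a (k |: (j |: S))).
have -> : kdiff (kdiff a) S =
    \sum_(j | j \notin S) \sum_(k | (k \notin S) && (k < j)%N) b j k +
    \sum_(j | j \notin S) \sum_(k | (k \notin S) && (j < k)%N) b j k.
  rewrite -big_split; apply: eq_bigr => j jS /=.
  rewrite /kdiff scaler_sumr (bigID (fun k : 'I_n => (k < j)%N)) /=.
  congr (_ + _); apply: eq_bigl => k; rewrite !inE negb_or -val_eqE /=;
    by case: ltngtP; rewrite ?andbF ?andbT.
rewrite (exchange_big_dep (fun k => k \notin S)) => [|j k _ /andP[]] //=.
rewrite -big_split big1 // => j jS /=.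
rewrite [X in X + _](eq_bigl (fun k => (k \notin S) && (j < k)%N)) => [|k].
  rewrite -big_split big1 // => k /andP[kS jk] /=.
  rewrite /b setUCA !scalerA -scalerDl !ksignU1 // jk ltnNge (ltnW jk) /=.
  by rewrite expr1 expr0 mul1r mulN1r mulrN [X in _ + X]mulrC addNr scale0r.
by rewrite jS.
Qed.

(* The contracting homotopy inserts the largest element [m] of the simplex
   carrying [a]; the sign of a largest element is [1]. *)
Definition kcone a (m : 'I_n) S : V := if m \in S then a (S :\ m) else 0.

Lemma kdiff_kcone a (m : 'I_n) :
    (forall S, a S != 0 -> forall k, k \in S -> (k <= m)%N) ->
    (forall S, kdiff a S = 0) ->
  forall S, kdiff (kcone a m) S = a S.
Proof.
move=> am da S; have [mS|mS] := boolP (m \in S); last first.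
  (* For [m] outside [S] only the term [j = m] survives. *)
  rewrite /kdiff (bigD1 m) //= big1 ?addr0 => [|j /andP[jS jm]].
    rewrite /kcone setU11 setU1K //; have [->|aS] := eqVneq (a S) 0.
      by rewrite scaler0.
    by rewrite ksign_max ?scale1r //; exact: am.
  by rewrite /kcone !inE eq_sym (negPf jm) (negPf mS) scaler0.
(* For [m] in [S], the cycle condition at [S :\ m] expresses [a S] through the other terms; their
   signs match because adding [m] flips the sign of each [j < m]. *)
have := da (S :\ m); rewrite /kdiff (bigD1 m) /=; last by rewrite !inE eqxx.
move/(congr1 ( *:%R (ksign K (S :\ m) m))).
rewrite scalerDr scalerA ksign_sq scale1r setD1K // scaler0 scaler_sumr.
move/eqP; rewrite addr_eq0 => /eqP ->; rewrite -sumrN.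
apply: eq_big => [j|j jS].
  by rewrite !inE; case: eqVneq => [->|]; rewrite ?mS ?andbT ?andbF.
have jm : j != m by apply: contraNneq jS => ->.
have SE : j |: S :\ m = (j |: S) :\ m.
  by apply/setP=> k; rewrite !inE; case: (eqVneq k j) => // ->; rewrite jm.
rewrite /kcone !inE mS orbT -SE.
have [->|nz] := eqVneq (a (j |: S :\ m)) 0; first by rewrite !scaler0 oppr0.
have le_m k : k \in j |: S :\ m -> (k <= m)%N by exact: am.
have jltm : (j < m)%N by rewrite ltn_neqAle val_eqE jm le_m ?setU11.
have -> : ksign K S j = - ksign K (S :\ m) j.
  by rewrite -{1}(setD1K mS) ksignU1 ?setD11 // jltm mulN1r.
rewrite scaleNr (@ksign_max _ _ _ m).
  by rewrite scale1r.
by move=> k kS; rewrite le_m // inE kS orbT.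
Qed.
End KoszulDifferential.

(** * The total complex *)

Section TotalComplex.
Variables (F : fieldType) (X : cellComplex F) (n : nat).
Implicit Types (S : {set 'I_n}).

(** Each component ranges over all chains of [X], so inclusions of levels become identities; levels
    and degrees are imposed by the subspaces [tchains]. *)
Definition total : vectType F := {ffun {set 'I_n} -> chain X}.

Implicit Types (x z : total).

Definition tdiff_fun x : total :=
  [ffun S : {set 'I_n} => (-1) ^+ #|S| *: bd X (x S) + kdiff x S].

Lemma tdiff_fun_is_linear : linear tdiff_fun.
Proof.
move=> a x y; apply/ffunP=> S; rewrite !ffunE linearP scalerDr.
rewrite scalerA mulrC -scalerA scalerDr -!addrA; congr (_ + _).
rewrite addrCA; congr (_ + _); rewrite /kdiff scaler_sumr -big_split /=.
by apply: eq_bigr => j _; rewrite !ffunE scalerDr !scalerA mulrC.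
Qed.
HB.instance Definition _ := GRing.isSemilinear.Build F total total _
  tdiff_fun (GRing.semilinear_linear tdiff_fun_is_linear).

Definition tdiff : 'End(total) := linfun tdiff_fun.

Lemma tdiffE x S : tdiff x S = (-1) ^+ #|S| *: bd X (x S) + kdiff x S.
Proof. by rewrite lfunE /= ffunE. Qed.

(** Adding an element to [S] changes the sign [(-1) ^+ #|S|], so the mixed terms cancel. *)
Lemma tdiff_tdiff x : tdiff (tdiff x) = 0.
Proof.
apply/ffunP=> S; rewrite tdiffE {1}tdiffE linearD linearZ /= bd_bd scaler0 add0r.
have -> : kdiff (tdiff x) S =
    kdiff (fun S => (-1) ^+ #|S| *: bd X (x S)) S + kdiff (kdiff x) S.
  by rewrite /kdiff -big_split; apply: eq_bigr => j _; rewrite tdiffE scalerDr.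
rewrite kdiff_kdiff addr0 /kdiff linear_sum scaler_sumr -big_split big1 ?ffunE //.
move=> j jS; rewrite linearZ /= cardsU1 jS /= !scalerA -scalerDl.
by rewrite exprS mulN1r mulrN mulrC subrr scale0r.
Qed.

Lemma kdiff_ffunE (x : {set 'I_n} -> chain X) S s :
  kdiff x S s = kdiff (fun T => x T s : F^o) S.
Proof. by rewrite sum_ffunE; apply: eq_bigr => j _; rewrite ffunE. Qed.

Lemma kdiff_neq0 x S s : kdiff x S s != 0 ->
  exists2 j, j \notin S & x (j |: S) s != 0.
Proof.
move/eqP=> nz; apply/exists_inP; apply: contra_notT nz => /exists_inPn H.
rewrite sum_ffunE big1 // => j /H/negPn/eqP jS; by rewrite ffunE jS scaler0.
Qed.

Lemma kdiff_eq0 (V : lmodType F) (a : {set 'I_n} -> V) S :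
  (forall j, j \notin S -> a (j |: S) = 0) -> kdiff a S = 0.
Proof. by move=> H; apply: big1 => j /H ->; rewrite scaler0. Qed.

Section Support.
Variable P : {set 'I_n} -> X -> bool.

Definition cut x : total := [ffun S : {set 'I_n} => [ffun s => if P S s then x S s else 0]].

Lemma cut_is_linear : linear cut.
Proof.
move=> a x y; apply/ffunP=> S; apply/ffunP=> s; rewrite !ffunE.
by case: ifP; rewrite // scaler0 addr0.
Qed.
HB.instance Definition _ := GRing.isSemilinear.Build F total total _
  cut (GRing.semilinear_linear cut_is_linear).
End Support.

Definition supp (P : {set 'I_n} -> X -> bool) : {vspace total} :=
  lker (linfun (cut (fun S s => ~~ P S s))).

Lemma mem_supp (P : {set 'I_n} -> X -> bool) x :
  reflect (forall S s, x S s != 0 -> P S s) (x \in supp P).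
Proof.
rewrite memv_ker lfunE /=; apply: (iffP eqP) => [x0 S s|H].
  apply: contraNT => nP; move/ffunP/(_ S)/ffunP/(_ s): x0.
  by rewrite !ffunE nP => ->.
apply/ffunP=> S; apply/ffunP=> s; rewrite !ffunE.
by case: ifPn => // /negP nP; apply/eqP; apply: contra_notT nP => /H.
Qed.
End TotalComplex.

(** * Levels of the filtration and lifting of relative cycles *)

Section Levels.
Variables (F : fieldType) (X : cellComplex F) (n : nat) (Xf : filtration X n).
Variable u : grade n.
Implicit Types (S : {set 'I_n}) (x z : total X n).

Local Notation L S := (Xf (u - e_set S)).
Local Notation B := (\bigcup_(j < n) Xf (u - delta_mx 0 j)).

Lemma e_setE S k : e_set S 0 k = (k \in S)%:R.
Proof.
rewrite summxE; have [kS|kS] := boolP (k \in S).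
  rewrite (bigD1 k) //= mxE !eqxx big1 ?addr0 // => j /andP[_ jk].
  by rewrite mxE eq_sym (negPf jk).
by rewrite big1 // => j jS; rewrite mxE; case: (eqVneq k j) jS kS => // -> ->.
Qed.

Lemma level0 : L set0 = Xf u.
Proof. by rewrite /e_set big_set0 subr0. Qed.

Lemma level1 j : L [set j] = Xf (u - delta_mx 0 j).
Proof. by rewrite /e_set big_set1. Qed.

Lemma level_subset S S' : S \subset S' -> L S' \subset L S.
Proof.
move=> SS'; apply: level_mono; apply/forallP=> k; rewrite !mxE !e_setE lerD2l lerN2.
by rewrite ler_nat; case: (boolP (k \in S)) => // /(subsetP SS') ->.
Qed.

(** One-criticality enters here: a grade below [u - e_set S] and [u - e_set [set j]] is below their
    coordinatewise minimum. *)
Lemma level_setU1 S j s : s \in L S -> s \in L [set j] -> s \in L (j |: S).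
Proof.
have [f [_ fE]] := level_one_critical Xf; rewrite !fE !inE.
move=> /forallP sS /forallP sj; apply/forallP=> k.
move: (sS k) (sj k); rewrite !mxE !e_setE !inE.
by case: (k == j) => //=; rewrite subr0.
Qed.

Lemma mem_lower s : reflect (exists j, s \in L [set j]) (s \in B).
Proof.
apply: (iffP bigcupP) => [[j _]|[j]]; first by rewrite -level1; exists j.
by rewrite level1; exists j.
Qed.

Lemma subcomplex_lower : subcomplex B.
Proof.
apply/subcomplexP=> t s /mem_lower[j tj] ts; apply/mem_lower; exists j.
by have /subcomplexP := level_subcomplex Xf (u - e_set [set j]); apply; last exact: ts.
Qed.

(** Provides the apex for [kcone]: the largest [m] with [s] in [L [set m]], since [s] in [L S]
    forces [s] in [L [set k]] for each [k] in [S]. *)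
Lemma lower_max s : s \in B ->
  exists2 m, s \in L [set m] & forall S, s \in L S -> forall k, k \in S -> (k <= m)%N.
Proof.
case/mem_lower=> j0 sj0.
case: (@arg_maxnP _ j0 (fun j => s \in L [set j]) (@nat_of_ord n) sj0) => m sm mx.
exists m => // S sS k kS; apply: mx.
by apply: (subsetP (level_subset _)) sS; rewrite sub1set.
Qed.

(** Total degree [q], filtration degree below [k]; the strict bound makes [k = 0] the zero space and
    [k = n.+1] no restriction. *)
Definition tchains q k : {vspace total X n} :=
  supp (fun S s => [&& s \in L S, (cdim s + #|S|)%N == q & (#|S| < k)%N]).

Lemma mem_tchains q k x :
  reflect (forall S s, x S s != 0 ->
    [/\ s \in L S, (cdim s + #|S|)%N = q & (#|S| < k)%N])
  (x \in tchains q k).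
Proof.
apply: (iffP (mem_supp _ _)) => H S s /H.
  by case/and3P=> ? /eqP.
by case=> -> -> ->; rewrite eqxx.
Qed.

Lemma tdiff_support q k x S s : x \in tchains q k -> tdiff X n x S s != 0 ->
  [/\ s \in L S, (cdim s + #|S|).+1 = q & (#|S| < k)%N].
Proof.
move=> /mem_tchains xqk; rewrite tdiffE ffunE.
have [/eqP -> | /kdiff_neq0[j jS /xqk[sL + lt_k] _]] := boolP (kdiff x S s == 0).
  rewrite addr0 ffunE; have [->|/bd_neq0[t /xqk[tL dt lt_k] ts] _] :=
    eqVneq (bd X (x S) s) 0; first by rewrite scaler0 eqxx.
  split=> //; last by rewrite -dt (incid_dim ts).
  by have /subcomplexP := level_subcomplex Xf (u - e_set S); apply; last exact: ts.
rewrite cardsU1 jS addnCA add1n => <-; split=> //.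
  by apply: (subsetP (level_subset _)) sL; rewrite subsetUr.
by move: lt_k; rewrite cardsU1 jS => /ltnW.
Qed.

Definition tcycles q k : {vspace total X n} := (lker (tdiff X n) :&: tchains q k)%VS.

Lemma tcyclesP q k z :
  reflect (tdiff X n z = 0 /\ z \in tchains q k) (z \in tcycles q k).
Proof.
by rewrite memv_cap memv_ker; apply: (iffP andP) => -[/eqP dz zq]; split;
  rewrite -?dz.
Qed.

Lemma tchain_eq0 q k x S : x \in tchains q k -> (k <= #|S|)%N -> x S = 0.
Proof.
move=> /mem_tchains xqk kS; apply/ffunP=> s; rewrite ffunE; apply/eqP.
by apply: contraTT kS => /xqk[_ _]; rewrite ltnNge.
Qed.

(* [- tdiff z] is concentrated in level [k]; it is a Koszul cycle because
   [tdiff] squares to zero, hence a Koszul boundary by [kdiff_kcone] applied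
   cell by cell, and the primitive is the correction to [z] at level [k.+1]. *)
Lemma zigzag_step q k z c : c \in qchains (Xf u) q -> bd X c \in chains B ->
    z \in tchains q k.+1 -> z set0 = c ->
    (forall S, (#|S| < k)%N -> tdiff X n z S = 0) ->
  exists z', [/\ z' \in tchains q k.+2, z' set0 = c &
    forall S, (#|S| < k.+1)%N -> tdiff X n z' S = 0].
Proof.
move=> Cc Bc zq z0 dz.
pose w : total X n := - tdiff X n z.
have wsupp S s : w S s != 0 -> [/\ s \in L S, (cdim s + #|S|).+1 = q & #|S| = k].
  rewrite /w !ffunE oppr_eq0 => nz.
  have [sL dq lt_k] := tdiff_support zq nz; split=> //.
  apply/eqP; rewrite eqn_leq -ltnS lt_k leqNgt /=; apply: contra nz => /dz ->.
  by rewrite ffunE.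
have w_eq0 S : #|S| != k -> w S = 0.
  move=> Sk; apply/ffunP=> s; rewrite [RHS]ffunE; apply/eqP.
  by apply: contraNT Sk => /wsupp[_ _ ->].
have wB S s : w S s != 0 -> s \in B.
  move=> nz; have [sL _ Sk] := wsupp _ _ nz.
  (* A nonempty [S] gives a level inside some [L [set j]]; for [S = set0], where [k = 0], the value
     is [- bd X c], supported in [B] by hypothesis. *)
  have [S0|[j jS]] := set_0Vmem S; last first.
    by apply/mem_lower; exists j; apply: (subsetP (level_subset _)) sL; rewrite sub1set.
  move: nz; rewrite S0 !ffunE tdiffE oppr_eq0 kdiff_eq0.
    rewrite z0 cards0 scale1r addr0; exact/mem_chains.
  by move=> j jS; apply: (tchain_eq0 zq); rewrite -Sk S0 cardsU1 inE cards0.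
have kdw S : kdiff w S = 0.
  (* At level [k - 1] the component [w S] is zero, so [kdiff w S] is all of [tdiff X n w S]. *)
  have [Sk|Sk] := eqVneq #|S|.+1 k; last first.
    by apply: kdiff_eq0 => j jS; apply: w_eq0; rewrite cardsU1 jS.
  have := tdiffE w S; rewrite w_eq0 ?linear0 ?scaler0 ?add0r; last first.
    by rewrite -Sk neq_ltn ltnSn.
  by move=> <-; rewrite /w linearN /= tdiff_tdiff oppr0 ffunE.
have vP s : exists b : {set 'I_n} -> F^o, (forall S, kdiff b S = w S s) /\
    forall S, b S != 0 -> s \in L S /\ exists2 j, j \in S & w (S :\ j) s != 0.
  have [/lower_max[m sm mx]|sB] := boolP (s \in B); last first.
    exists (fun=> 0); split=> S; last by rewrite eqxx.
    by rewrite kdiff_eq0 //; apply/esym/eqP; apply: contraNT sB => /wB.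
  exists (kcone (fun S => w S s) m); split=> [S|S]; last first.
    rewrite /kcone; case: ifPn => [mS nz|]; last by rewrite eqxx.
    split; last by exists m.
    by have [sL _ _] := wsupp _ _ nz; rewrite -(setD1K mS) level_setU1.
  apply: kdiff_kcone => [T /wsupp[sL _ _]|T]; first exact: mx.
  by rewrite -kdiff_ffunE kdw ffunE.
have [b bP] := fin_all_exists vP.
pose v : total X n := [ffun S : {set 'I_n} => [ffun s => b s S]].
have vsupp S s : v S s != 0 -> [/\ s \in L S, (cdim s + #|S|)%N = q & #|S| = k.+1].
  rewrite !ffunE => /(proj2 (bP s))[sL [j jS] /wsupp[_ dq Sk]].
  by rewrite (cardsD1 j S) jS Sk -dq Sk addnCA.
have v_eq0 S : #|S| != k.+1 -> v S = 0.
  move=> Sk; apply/ffunP=> s; rewrite [RHS]ffunE; apply/eqP.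
  by apply: contraNT Sk => /vsupp[_ _ ->].
exists (z + v); split.
- rewrite memvD //; apply/mem_tchains => S s; last by case/vsupp=> ? ? Sk; split=> //; rewrite Sk.
  by move/(mem_tchains _ _ _ zq) => [? ? ?]; split=> //; exact: ltnW.
- by rewrite ffunE v_eq0 ?cards0 // addr0.
- move=> S Sk; rewrite linearD ffunE [tdiff X n v S]tdiffE v_eq0; last first.
    by rewrite neq_ltn Sk.
  rewrite linear0 scaler0 add0r; apply/ffunP=> s; rewrite ffunE kdiff_ffunE.
  transitivity (tdiff X n z S s + w S s); last by rewrite !ffunE subrr.
  congr (_ + _); rewrite -(proj1 (bP s)).
  by apply: eq_bigr => j _; rewrite !ffunE.
Qed.

Lemma relative_cycle_lift q c : c \in qchains (Xf u) q -> bd X c \in chains B ->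
  exists2 z, z \in tcycles q n.+1 & z set0 = c.
Proof.
move=> Cc Bc.
have zk k : exists z, [/\ z \in tchains q k.+1, z set0 = c &
    forall S, (#|S| < k)%N -> tdiff X n z S = 0].
  elim: k => [|k [z [zq z0 dz]]]; last exact: zigzag_step dz.
  exists [ffun S : {set 'I_n} => if S == set0 then c else 0]; split=> //; last by rewrite ffunE eqxx.
  apply/mem_tchains => S s; rewrite ffunE; case: (S =P set0) => [->|_]; last by rewrite ffunE eqxx.
  by move/mem_qchains: Cc => H /H[]; rewrite level0 cards0 addn0.
(* Stage [n.+1] is enough: a set of parameters has at most [n] elements. *)
have [z [zq z0 dz]] := zk n.+1; exists z => //.
have ltn S : (#|S| < n.+1)%N by rewrite ltnS -[n in (_ <= n)%N]card_ord max_card.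
apply/tcyclesP; split; first by apply/ffunP=> S; rewrite dz // ffunE.
by apply/mem_tchains => S s /(mem_tchains _ _ _ zq)[].
Qed.

(** * The edge map to relative homology *)

Definition rel_class q (c : chain X) : Hq_rel (Xf u) B q :=
  hclass (qmap (bd X) (chains B) (chains B)) (rel_qchains (Xf u) B) q
    (qpi (chains B) c).

Lemma qmap_bd c : qmap (bd X) (chains B) (chains B) (qpi (chains B) c) =
  qpi (chains B) (bd X c).
Proof. by rewrite qmapE //; exact: subcomplex_lower. Qed.

Lemma rel_class_surj q (h : Hq_rel (Xf u) B q) :
  exists c, [/\ c \in qchains (Xf u) q, bd X c \in chains B & h = rel_class q c].
Proof.
have [z + ->] := hclass_surj h; rewrite memv_cap memv_ker.
case/andP=> /memv_imgP[c Cc ->]; rewrite lfunE /= qmap_bd qpi_eq0 => Bc.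
by exists c.
Qed.

Lemma rel_class_bd q t b : t \in qchains (Xf u) q.+1 -> b \in chains B ->
  rel_class q (bd X t + b) = 0.
Proof.
move=> Ct Bb; rewrite /rel_class linearD /= (_ : qpi _ b = 0) ?addr0; last first.
  by apply/eqP; rewrite qpi_eq0.
apply/eqP; rewrite hclass_eq0; last first.
  rewrite memv_cap memv_ker qmap_bd bd_bd linear0 eqxx andbT.
  apply/memv_imgP; exists (bd X t); last by rewrite [RHS]lfunE.
  by apply: bd_qchains Ct; exact: level_subcomplex.
rewrite -qmap_bd memv_img //; apply/memv_imgP; exists t => //; by rewrite [RHS]lfunE.
Qed.

(** Meaningful on [tcycles]: there [bd X (x set0)] is [- kdiff x set0], a chain of [B]. *)
Definition edge_fun q x : Hq_rel (Xf u) B q := rel_class q (x set0).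

Lemma edge_fun_is_linear q : linear (edge_fun q).
Proof. by move=> a x y; rewrite /edge_fun /rel_class !ffunE !linearP. Qed.
HB.instance Definition _ q := GRing.isSemilinear.Build F (total X n) _ _
  (edge_fun q) (GRing.semilinear_linear (@edge_fun_is_linear q)).

Definition edge q : 'Hom(total X n, Hq_rel (Xf u) B q) := linfun (edge_fun q).

Lemma edgeE q x : edge q x = rel_class q (x set0).
Proof. by rewrite lfunE. Qed.

Lemma edge_surj q : (edge q @: tcycles q n.+1)%VS = fullv.
Proof.
apply/eqP; rewrite eqEsubv subvf; apply/subvP=> h _.
have [c [Cc Bc ->]] := rel_class_surj h.
have [z Zz <-] := relative_cycle_lift Cc Bc.
by rewrite -edgeE memv_img.
Qed.

(** At the empty set [tdiff] is a boundary plus chains of lower levels, which vanish in the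
    quotient. *)
Lemma edge_tdiff q k t : t \in tchains q.+1 k -> edge q (tdiff X n t) = 0.
Proof.
move=> /mem_tchains tq; rewrite edgeE tdiffE cards0 scale1r rel_class_bd //.
  apply/mem_qchains => s /tq[]; rewrite level0 cards0 addn0 => sX dq _.
  by split.
apply/mem_chains => s /kdiff_neq0[j _ /tq[]]; rewrite setU0 => sj _ _.
by apply/mem_lower; exists j.
Qed.

(** * Leading terms as Koszul homology classes *)

Section KoszulClasses.
Variable p : nat.
Local Notation Z S := (cycles (bd X) (qchains (L S)) p).

Lemma koszul_sumE (I : finType) (P : pred I) (v : I -> koszul Xf p u) S :
  (\sum_(i | P i) v i) S = \sum_(i | P i) v i S.
Proof.
by elim/big_rec2: _ => [|i y1 y2 _ <-]; [exact: dsum0 | exact: dsumD].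
Qed.

Lemma koszul_grP (y : koszul Xf p u) i :
  reflect (forall S, #|S| != i -> y S = 0) (y \in koszul_gr Xf p u i).
Proof.
apply: (iffP memv_sumP) => [[v vP -> S Si]|y0].
  rewrite koszul_sumE big1 // => T Ti.
  have /memv_imgP[w _ ->] := vP T Ti; rewrite lfunE /= ffunE dfwith_out //.
  by apply: contraNneq Si => <-.
exists (fun S => dsum_in (y S)) => [S _|].
  by apply/memv_imgP; exists (y S); rewrite ?memvf ?lfunE.
apply/ffunP=> S; rewrite [RHS]koszul_sumE.
have [Si|Si] := eqVneq #|S| i.
  rewrite (bigD1 S) ?Si //= ffunE dfwith_in big1 ?addr0 // => T /andP[_ TS].
  by rewrite ffunE dfwith_out.
rewrite y0 // big1 // => T /eqP Ti; rewrite ffunE dfwith_out //.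
by apply: contraNneq Si => <-; apply/eqP.
Qed.

(** Meaningful when every component is a [p]-cycle of its level; elsewhere only linearity
    matters. *)
Definition koszul_class_fun x : koszul Xf p u :=
  dsum_of (fun S => hclass (bd X) (qchains (L S)) p (x S)).

Lemma koszul_class_fun_is_linear : linear koszul_class_fun.
Proof.
by move=> a x y; apply/ffunP=> S; rewrite dsumD dsumZ !ffunE linearP.
Qed.
HB.instance Definition _ := GRing.isSemilinear.Build F (total X n) _ _
  koszul_class_fun (GRing.semilinear_linear koszul_class_fun_is_linear).

Definition koszul_class : 'Hom(total X n, koszul Xf p u) :=
  linfun koszul_class_fun.

Lemma koszul_classE x S :
  koszul_class x S = hclass (bd X) (qchains (L S)) p (x S).
Proof. by rewrite lfunE /= ffunE. Qed.

Lemma dsum_in_hclass S S' c :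
  (dsum_in (hclass (bd X) (qchains (L S)) p c) : koszul Xf p u) S' =
  if S == S' then hclass (bd X) (qchains (L S')) p c else 0.
Proof.
rewrite ffunE; case: eqVneq => [<-|SS']; first by rewrite dfwith_in.
by rewrite dfwith_out.
Qed.

Lemma cycles_subset S S' : S \subset S' -> (Z S' <= Z S)%VS.
Proof.
by move=> SS'; apply: capvS (subvv _); apply/qchainsS/level_subset.
Qed.

(** Inclusions keep representatives; grouped by target, the only [T] containing [j] with
    [T :\ j = S] is [j |: S]. *)
Lemma koszul_diff_class x : (forall S, x S \in Z S) ->
  koszul_diff Xf p u (koszul_class x) =
  koszul_class [ffun S : {set 'I_n} => kdiff x S].
Proof.
move=> Zx; apply/ffunP=> S; rewrite koszul_classE ffunE lfunE /= /koszul_fun.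
rewrite koszul_sumE.
under eq_bigr => T _.
  rewrite koszul_sumE.
  under eq_bigr => j jT.
    rewrite dsumZ koszul_classE Hincl_hclass ?level_subset ?subD1set //.
    rewrite dsum_in_hclass.
    over.
  over.
rewrite /kdiff [RHS]linear_sum /= (exchange_big_dep xpredT) //= [RHS]big_mkcond /=.
apply: eq_bigr => j _; case: ifPn => jS.
  rewrite (bigD1 (j |: S)) ?setU11 //= setU1K // eqxx big1 ?addr0.
    by rewrite linearZ /= -[ksign _ _ _]ksignU1id.
  move=> T /andP[jT TS]; case: eqP => [TjS|]; last by rewrite scaler0.
  by rewrite -TjS setD1K // eqxx in TS.
rewrite big1 // => T jT; case: eqP => [TjS|]; last by rewrite scaler0.
by rewrite -TjS setD11 in jS.
Qed.

Definition truncate i : 'Hom(total X n, total X n) :=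
  linfun (@cut F X n (fun S _ => #|S| == i)).

Lemma truncateE i x S : truncate i x S = if #|S| == i then x S else 0.
Proof.
by rewrite lfunE /=; apply/ffunP=> s; rewrite !ffunE; case: ifP; rewrite ?ffunE.
Qed.

(** The leading term of a cycle, meaningful on [tcycles (p + i) i.+1] by [truncate_cycles]. *)
Definition column_fun i x : homology (koszul_diff Xf p u) (koszul_gr Xf p u) i :=
  hclass (koszul_diff Xf p u) (koszul_gr Xf p u) i (koszul_class (truncate i x)).

Lemma column_fun_is_linear i : linear (column_fun i).
Proof. by move=> a x y; rewrite /column_fun !linearP. Qed.
HB.instance Definition _ i := GRing.isSemilinear.Build F (total X n) _ _
  (column_fun i) (GRing.semilinear_linear (@column_fun_is_linear i)).

Definition column i :
    'Hom(total X n, homology (koszul_diff Xf p u) (koszul_gr Xf p u) i) :=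
  linfun (column_fun i).

(** At the top level [kdiff] vanishes, so [tdiff] is the cellular boundary up to sign. *)
Lemma tcycles_top k z S : z \in tcycles (p + k)%N k.+1 -> #|S| = k -> z S \in Z S.
Proof.
case/tcyclesP=> dz zq Sk; rewrite memv_cap memv_ker; apply/andP; split.
  apply/mem_qchains => s /(mem_tchains _ _ _ zq)[sL + _]; rewrite Sk => /addIn.
  by split.
move/ffunP/(_ S)/eqP: dz; rewrite tdiffE [X in _ == X]ffunE kdiff_eq0 ?addr0.
  by rewrite scaler_eq0 signr_eq0.
by move=> j jS; apply: (tchain_eq0 zq); rewrite cardsU1 jS Sk.
Qed.

(** One level below the top, the cycle equation equates [kdiff z S] with [bd X (z S)] up to sign,
    which is zero in homology. *)
Lemma truncate_cycles k z : z \in tcycles (p + k)%N k.+1 ->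
  koszul_class (truncate k z) \in
    cycles (koszul_diff Xf p u) (koszul_gr Xf p u) k.
Proof.
move=> Zz; rewrite memv_cap memv_ker; apply/andP; split.
  by apply/koszul_grP => S /negPf Sk; rewrite koszul_classE truncateE Sk linear0.
rewrite koszul_diff_class => [|S]; last first.
  by rewrite truncateE; case: eqP => [/tcycles_top->|]; rewrite ?mem0v.
apply/eqP/ffunP=> S; rewrite koszul_classE ffunE dsum0.
have [Sk|Sk] := eqVneq #|S|.+1 k; last first.
  rewrite kdiff_eq0 ?linear0 // => j jS.
  by rewrite truncateE cardsU1 jS (negPf Sk).
have -> : kdiff (truncate k z) S = kdiff z S.
  by apply: eq_bigr => j jS; rewrite truncateE cardsU1 jS add1n Sk eqxx.
have [dz zq] := tcyclesP _ _ _ Zz.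
move/ffunP/(_ S)/eqP: dz.
rewrite tdiffE [X in _ == X]ffunE addrC addr_eq0 => /eqP ->.
rewrite linearN linearZ /=; apply/eqP; rewrite oppr_eq0 scaler_eq0 signr_eq0 /=.
have zS : z S \in qchains (L S) p.+1.
  apply/mem_qchains => s /(mem_tchains _ _ _ zq)[sL + _].
  by rewrite -Sk -addSnnS => /addIn.
rewrite hclass_eq0 ?memv_img // memv_cap memv_ker bd_bd eqxx andbT.
exact/bd_qchains/zS/level_subcomplex.
Qed.

(** A Koszul primitive of the leading term yields [t] such that [z - tdiff X n t] has no level [k];
    the edge class is unchanged by [edge_tdiff]. *)
Lemma column_kernel k z : z \in tcycles (p + k)%N k.+1 -> column k z = 0 ->
  edge (p + k)%N z \in (edge (p + k)%N @: tcycles (p + k)%N k)%VS.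
Proof.
move=> Zz /eqP; rewrite lfunE /= hclass_eq0 ?truncate_cycles //.
case/memv_imgP=> y /koszul_grP y0 zy.
pose r : total X n := [ffun S : {set 'I_n} => vsval (qrepr (y S))].
pose r' := truncate k.+1 r.
have r'Z S : r' S \in Z S.
  by rewrite truncateE; case: eqP; rewrite ?mem0v // ffunE subvsP.
have ry : koszul_class r' = y.
  apply/ffunP=> S; rewrite koszul_classE truncateE; case: eqVneq => [_|/y0 ->].
    by rewrite ffunE /hclass vsvalK qreprK.
  by rewrite linear0.
(* At level [k], [z S] and [kdiff r' S] have the same class in the homology of [L S], hence differ
   by a boundary. *)
have [w wP] : exists w : {set 'I_n} -> chain X, forall S,
    w S \in qchains (L S) p.+1 /\ (#|S| = k -> z S = kdiff r' S + bd X (w S)).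
  suff wS S : exists w : chain X, w \in qchains (L S) p.+1 /\
      (#|S| = k -> z S = kdiff r' S + bd X w).
    by have [w wP] := fin_all_exists wS; exists w.
  have [Sk|Sk] := eqVneq #|S| k; last first.
    by exists 0; split; rewrite ?mem0v // => /eqP; rewrite (negPf Sk).
  have kdZ : kdiff r' S \in Z S.
    apply: rpred_sum => j _; rewrite memvZ //.
    by apply: (subvP (cycles_subset _)) (r'Z _); rewrite subsetUr.
  have /memv_imgP[w Cw zw] :
      z S - kdiff r' S \in boundaries (bd X) (qchains (L S)) p.
    rewrite -hclass_eq0 ?memvB // ?(tcycles_top Zz) // linearB subr_eq0 /=.
    move/ffunP/(_ S): zy; rewrite -ry koszul_diff_class // !koszul_classE.
    by rewrite truncateE Sk eqxx ffunE => ->.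
  by exists w; split=> // _; rewrite -zw addrC subrK.
(* The factor [(-1) ^+ k] cancels the sign in [tdiff], so [tdiff X n t] equals [z] at level [k]. *)
pose t : total X n := [ffun S : {set 'I_n} =>
  r' S + (if #|S| == k then (-1) ^+ k *: w S else 0)].
have tk S : #|S| = k -> t S = (-1) ^+ k *: w S.
  by move=> Sk; rewrite ffunE truncateE Sk eqxx ltn_eqF ?add0r.
have tk1 S : #|S| != k -> t S = r' S.
  by move=> /negPf Sk; rewrite ffunE Sk addr0.
have tq : t \in tchains (p + k)%N.+1 k.+2.
  apply/mem_tchains => S s; have [Sk|Sk] := eqVneq #|S| k.
    rewrite tk // ffunE scaler_eq0 negb_or => /andP[_].
    by move/(mem_qchains _ _ _ (proj1 (wP S))) => -[sL ->]; rewrite Sk.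
  rewrite tk1 // => nz; have /memv_capP[/mem_qchains/(_ s nz)[sL ->] _] := r'Z S.
  move: nz; rewrite truncateE; case: (#|S| =P k.+1) => [->|_]; last by rewrite ffunE eqxx.
  by rewrite addnS.
have [dz zq] := tcyclesP _ _ _ Zz.
apply/memv_imgP; exists (z - tdiff X n t); last first.
  by rewrite linearB /= (edge_tdiff tq) subr0.
have high S : (k <= #|S|)%N -> (z - tdiff X n t) S = 0.
  move=> kS; rewrite !ffunE tdiffE.
  have [Sk|Sk] := eqVneq #|S| k.
    have -> : kdiff t S = kdiff r' S.
      apply: eq_bigr => j jS.
      by rewrite tk1 // cardsU1 jS Sk neq_ltn ltnSn orbT.
    rewrite (proj2 (wP S) Sk) tk // Sk linearZ scalerA /= -expr2 sqrr_sign.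
    by rewrite scale1r [X in X - _]addrC subrr.
  (* Above level [k], [z] vanishes, and so does [tdiff X n t]: [r'] consists of cycles and [t] stops
     at level [k.+1]. *)
  have ltS : (k < #|S|)%N by rewrite ltn_neqAle eq_sym Sk.
  rewrite (tchain_eq0 zq) // kdiff_eq0 ?tk1 // => [|j jS].
    have /memv_capP[_] := r'Z S; rewrite memv_ker => /eqP ->.
    by rewrite scaler0 addr0 subrr.
  by apply: (tchain_eq0 tq); rewrite cardsU1 jS.
apply/tcyclesP; rewrite linearB /= tdiff_tdiff dz subrr; split=> //.
apply/mem_tchains => S s nz.
have ltS : (#|S| < k)%N.
  by rewrite ltnNge; apply: contra nz => /high ->; rewrite ffunE.
have [zS|/(mem_tchains _ _ _ zq)[] //] := eqVneq (z S s) 0.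
move: nz; rewrite !ffunE zS add0r oppr_eq0 => /(tdiff_support tq)[sL dS _].
by split=> //; apply: succn_inj.
Qed.
End KoszulClasses.

(** Induction on the filtration: by [dim_limg_step] with [g] the map [column], each level adds at
    most one Betti number. *)
Lemma dim_edge_tcycles q k :
  (\dim (edge q @: tcycles q k) <= \sum_(i < k) betti Xf i (q%:Z - i%:Z) u)%N.
Proof.
elim: k => [|k IHk].
  rewrite big_ord0 leqn0 dimv_eq0 -subv0; apply/subvP=> _ /memv_imgP[z + ->].
  case/tcyclesP=> _ zq; suff -> : z = 0 by rewrite linear0 mem0v.
  by apply/ffunP=> S; rewrite (tchain_eq0 zq) ?ffunE.
rewrite big_ord_recr /=; apply: leq_trans (leq_add IHk (leqnn _)).
have [kq|qk] := leqP k q.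
  rewrite subzn //=; move: (q - k)%N (subnK kq) => p pkq; subst q.
  apply: (dim_limg_step (g := column p k)) => z.
  exact: column_kernel.
(* For [k > q], level [k] would need cells of negative dimension, so it adds nothing. *)
apply: leq_trans (leq_addr _ _); apply/dimvS/limgS/capvS => //.
apply/subvP=> z zq; apply/mem_tchains => S s /(mem_tchains _ _ _ zq)[sL dq Sk].
split=> //; apply: leq_ltn_trans qk; by rewrite -dq leq_addl.
Qed.
End Levels.

Theorem theorem7p5 (F : fieldType) (X : cellComplex F) (n : nat)
    (n_gt0 : (0 < n)%N) (Xf : filtration X n) (u : grade n) (q : nat) :
  (morse Xf q u <= \sum_(i < n.+1) betti Xf i (q%:Z - (i : nat)%:Z) u)%N.
Proof. by rewrite /morse -(edge_surj Xf u q); exact: dim_edge_tcycles. Qed.
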